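(* Let $\delta>0$ be a real number and let $L_\delta$ be an integer with $L_\delta\ge -1$ and $\frac{p_{L_\delta+2}}{p_{L_\delta+2}-1}\le 1+\delta$. Then for all real $t\ge 0$, $$ \Psi(\Phi^{-1}(t)) \leq \Psi(L_\delta)\cdot (1 + \delta)^{1 + \frac{t}{\log 2}}. $$
   Context: Let $p_i$ be the $i$-th prime indexed from $0$ ($p_0=2,p_1=3,p_2=5,\dots$). For integers $n\ge0$, $\Phi(n)=\sum_{i=0}^n\log(p_i-1)$ (natural logarithm); for integers $n\ge -1$, $\Psi(n)=\prod_{i=0}^{n+1}\frac{p_i}{p_i-1}$; for real $t\ge0$, $\Phi^{-1}(t)=\max\{n\in\mathbb{Z}_{\ge0}:\Phi(n)\le t\}$. *)

(* Defs.v *)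
From HB Require Import structures.
From mathcomp Require Import all_boot all_order all_algebra.
From mathcomp Require Import all_classical all_reals all_analysis.

Set Implicit Arguments.
Unset Strict Implicit.
Unset Printing Implicit Defensive.

Import Order.TTheory GRing.Theory Num.Theory.

Local Open Scope classical_set_scope.
Local Open Scope ring_scope.

Lemma next_prime_ex (m : nat) : exists q : nat, (m < q)%N && prime q.
Proof. by have [q mq pq] := prime_above m; exists q; rewrite mq pq. Qed.

Definition next_prime (m : nat) : nat := ex_minn (next_prime_ex m).

(* [nth_prime 0 = 2], [nth_prime 1 = 3], [nth_prime 2 = 5], ... *)
Definition nth_prime (i : nat) : nat := iter i next_prime 2.

Definition Phi (R : realType) (n : nat) : R :=
  \sum_(0 <= i < n.+1) ln ((nth_prime i)%:R - 1).

(* The product runs over i = 0, ..., n + 1, i.e. over the first n + 2 primes.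
   Only the values at integers n >= -1 are meaningful, and for those
   [`|n + 2|%N] is n + 2 as a natural number. *)
Definition Psi (R : realType) (n : int) : R :=
  \prod_(0 <= i < `|(n + 2)%R|%N) ((nth_prime i)%:R / ((nth_prime i)%:R - 1)).

(* The default value 0 is only used when the maximum does not exist, which is
   the case exactly when t < 0; see [PhiInvP]. *)
Definition PhiInv (R : realType) (t : R) : nat :=
  xget 0%N [set n | Phi R n <= t /\ forall m, Phi R m <= t -> (m <= n)%N].

Lemma next_primeP (m : nat) :
  [/\ prime (next_prime m), (m < next_prime m)%N
    & forall q, prime q -> (m < q)%N -> (next_prime m <= q)%N].
Proof.
rewrite /next_prime; case: ex_minnP => q /andP[mq pq] qmin; split=> // r pr mr.
by apply: qmin; rewrite mr pr.
Qed.

Lemma nth_prime_prime (i : nat) : prime (nth_prime i).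
Proof.
case: i => [//|i]; rewrite /nth_prime iterS.
by have [] := next_primeP (iter i next_prime 2).
Qed.

Lemma nth_prime_lt (i : nat) : (nth_prime i < nth_prime i.+1)%N.
Proof.
rewrite [nth_prime i.+1]/nth_prime iterS.
by have [] := next_primeP (nth_prime i).
Qed.

Lemma nth_prime_onto (q : nat) : prime q -> exists i, nth_prime i = q.
Proof.
move=> pq.
have lei i : (i <= nth_prime i)%N.
  by elim: i => [//|i ih]; apply: leq_ltn_trans ih (nth_prime_lt i).
have ex : exists i, (q <= nth_prime i)%N by exists q.
case: (ex_minnP ex) => -[|i] qi imin.
  by exists 0%N; apply/eqP; rewrite eqn_leq qi andbT prime_gt1.
exists i.+1; apply/eqP; rewrite eqn_leq qi andbT.
rewrite [nth_prime i.+1]/nth_prime iterS.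
have [_ _ +] := next_primeP (nth_prime i); apply=> //.
by rewrite ltnNge; apply/negP => /imin; rewrite ltnn.
Qed.

Lemma Phi0 (R : realType) : Phi R 0 = 0.
Proof. by rewrite /Phi big_nat1 /= mulr2n addrK ln1. Qed.

Lemma Phi_ge (R : realType) (n : nat) : n%:R * ln 2 <= Phi R n.
Proof.
elim: n => [|n ih]; first by rewrite mul0r Phi0.
have -> : Phi R n.+1 = Phi R n + ln ((nth_prime n.+1)%:R - 1).
  by rewrite /Phi big_nat_recr.
rewrite -natr1 mulrDl mul1r lerD //.
have p3 : (2 < nth_prime n.+1)%N.
  exact: leq_ltn_trans (prime_gt1 (nth_prime_prime n)) (nth_prime_lt n).
have p2 : (2 : R) <= (nth_prime n.+1)%:R - 1.
  by rewrite lerBrDr natr1 ler_nat.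
by rewrite ler_ln // posrE //; apply: lt_le_trans p2.
Qed.

Lemma PhiInvP (R : realType) (t : R) : 0 <= t ->
  Phi R (PhiInv t) <= t /\ forall m, Phi R m <= t -> (m <= PhiInv t)%N.
Proof.
move=> t0; rewrite /PhiInv.
set P := [set n | _]; suff [n Pn] : exists n, P n by exact: (xgetI 0%N Pn).
have l2 : 0 < ln (2 : R) by rewrite ln_gt0 // ltr1n.
have ex : exists n, Phi R n <= t by exists 0%N; rewrite Phi0.
have bd n : Phi R n <= t -> (n <= Num.truncn (t / ln 2))%N.
  move=> nt; rewrite truncn_ge_nat ?divr_ge0 ?(ltW l2) //.
  by rewrite ler_pdivlMr //; apply: le_trans (Phi_ge R n) nt.
by case: (ex_maxnP ex bd) => n nt nmax; exists n.
Qed.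

(* Main.v *)
Require Import Defs.
From HB Require Import structures.
From mathcomp Require Import all_boot all_order all_algebra.
From mathcomp Require Import all_classical all_reals all_analysis.
From mathcomp Require Import zify ring lra.

Import Order.TTheory GRing.Theory Num.Theory.

Local Open Scope ring_scope.

(** Every factor of Psi past the index [L + 2] is at most [1 + delta].  Since
    [L + 2 >= 1], the product [Psi (PhiInv t)] has at most [PhiInv t + 1] such
    factors, and [PhiInv t <= t / ln 2] because [ln (p_i - 1) >= ln 2] for
    [i >= 1] and [Phi (PhiInv t) <= t]. *)

Definition prime_factor (R : realType) (i : nat) : R :=
  (nth_prime i)%:R / ((nth_prime i)%:R - 1).

(** The prime now occurs only once, in a reciprocal, so the lower bound 1 and the monotonicity in
    [i] can be read off. *)
Lemma prime_factorE (R : realType) (i : nat) :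
  prime_factor R i = 1 + ((nth_prime i)%:R - 1)^-1.
Proof.
have p1 : (1 : R) < (nth_prime i)%:R by rewrite ltr1n prime_gt1 ?nth_prime_prime.
by rewrite /prime_factor; field; rewrite subr_eq0 gt_eqF.
Qed.

Lemma prime_factor_ge1 (R : realType) (i : nat) : 1 <= prime_factor R i.
Proof.
rewrite prime_factorE lerDl invr_ge0 subr_ge0 ler1n.
exact/prime_gt0/nth_prime_prime.
Qed.

Lemma nth_prime_mono : {homo nth_prime : i j / (i <= j)%N}.
Proof. by apply: homo_leq => // [|i]; [exact: leq_trans|exact/ltnW/nth_prime_lt]. Qed.

Lemma prime_factor_anti (R : realType) :
  {homo prime_factor R : i j / (i <= j)%N >-> j <= i}.
Proof.
move=> i j ij; rewrite !prime_factorE lerD2l lef_pV2 ?posrE ?subr_gt0 ?ltr1n;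
  rewrite ?prime_gt1 ?nth_prime_prime //.
by rewrite lerD2r ler_nat nth_prime_mono.
Qed.

Lemma prod_prime_factor_mono (R : realType) :
  {homo (fun m => \prod_(0 <= i < m) prime_factor R i)
     : m n / (m <= n)%N >-> m <= n}.
Proof.
apply: homo_leq => [//|y x z|m]; first exact: le_trans.
rewrite big_nat_recr //= ler_peMr ?prime_factor_ge1 //.
by apply: prodr_ge0 => i _; exact: le_trans (prime_factor_ge1 R i).
Qed.

(** The factors decrease with the index, so the one bound at [k] controls all [m] factors from [k]
    on. *)
Lemma prod_prime_factor_le (R : realType) (c : R) (k m : nat) :
  prime_factor R k <= c ->
  \prod_(0 <= i < k + m) prime_factor R i
    <= \prod_(0 <= i < k) prime_factor R i * c ^+ m.
Proof.
have ge0 n : 0 <= \prod_(0 <= i < n) prime_factor R i.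
  by apply: prodr_ge0 => i _; exact: le_trans (prime_factor_ge1 R i).
move=> kc; elim: m => [|m ih]; first by rewrite addn0 mulr1.
rewrite addnS big_nat_recr //= exprSr mulrA ler_pM //.
  exact: le_trans (prime_factor_ge1 R _).
by apply: le_trans kc; apply: prime_factor_anti; exact: leq_addr.
Qed.

Theorem theorem1p5 (R : realType) (delta : R) (delta_gt0 : 0 < delta)
    (L : int) (L_ge : -1 <= L)
    (hL : (nth_prime `|(L + 2)%R|%N)%:R / ((nth_prime `|(L + 2)%R|%N)%:R - 1)
            <= 1 + delta :> R)
    (t : R) (t_ge0 : 0 <= t) :
  Psi R (PhiInv t)%:Z <= Psi R L * (1 + delta) `^ (1 + t / ln 2).
Proof.
have [Phi_le _] := PhiInvP t_ge0.
set n := PhiInv t in Phi_le *; rewrite /Psi.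
set k := absz (L + 2) in hL *.
have n_le : n%:R <= t / ln 2.
  rewrite ler_pdivlMr ?ln_gt0 ?ltr1n //.
  exact: le_trans (Phi_ge R n) Phi_le.
(* [L_ge] gives [1 <= k]. Padding the product to [k + n.+1] factors, all at least 1, avoids a case
   split on whether [n + 2] exceeds [k]. *)
have nk : (`|(n%:Z + 2)%R| <= k + n.+1)%N by rewrite /k; lia.
apply: le_trans (prod_prime_factor_mono R _ _ nk) _.
apply: le_trans (prod_prime_factor_le R _ _ n.+1 hL) _.
apply: ler_wpM2l.
  by apply: prodr_ge0 => i _; exact: le_trans (prime_factor_ge1 R i).
(* As a real power with base at least 1, [(1 + delta) ^+ n.+1] is monotone in its exponent, and
   [n_le] gives [n.+1 <= 1 + t / ln 2]. *)
rewrite -powR_mulrn; last by lra.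
by apply: ler_powR; [lra | rewrite -nat1r lerD2l].
Qed.
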